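(* Let $n\ge2$ and let $\varepsilon$ be an $n$-periodic sign function. There are three types of $n$-periodic trees $\mathcal{T}$ with sign function $\varepsilon$ (every such tree is of exactly one type): 1. Trees with slope zero: $\mathcal{T}/\mathbb{Z}$ has no oriented cycles. Equivalently, there exists an $n$-periodic morphism $P_{\mathcal{T}}\to\mathbb{R}$ with slope $0$. 2. Trees with positive slope: $\mathcal{T}$ has an infinite monotonically increasing path. Equivalently, every $n$-periodic morphism $P_{\mathcal{T}}\to\mathbb{R}$ has positive slope. 3. Trees with negative slope: $\mathcal{T}$ has an infinite monotonically decreasing path. Equivalently, every $n$-periodic morphism $P_{\mathcal{T}}\to\mathbb{R}$ has negative slope.
   Context: $\varepsilon:\mathbb{Z}\to\{+,-\}$ is $n$-periodic if $\varepsilon_{i+n}=\varepsilon_i$. An $n$-periodic poset is a set $P=\{p_i : i\in\mathbb{Z}\}$ (distinct $p_i$) with a partial order such that $p_i<p_j\Leftrightarrow p_{i+n}<p_{j+n}$. $p$ is a child of $q$ (and $q$ a parent of $p$) if $p<q$ and no $x$ satisfies $p<x<q$. The Hasse diagram is the directed graph with vertex set $P$ and an edge oriented from each child to each of its parents; it is required that whenever $p<q$ there is a directed path from $p$ to $q$. An edge with endpoints $p_i,p_j$, $i<j$, is written $\ell=(p_i,p_j)$. It has positive slope if $p_i<p_j$ ($p_j$ is then a right parent of $p_i$, and $p_i$ a left child of $p_j$) and negative slope if $p_i>p_j$ ($p_j$ is a right child of $p_i$, and $p_i$ a left parent of $p_j$). An $n$-periodic tree with sign function $\varepsilon$ is the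 Hasse diagram $\mathcal{T}$ of an $n$-periodic poset $P=P_{\mathcal{T}}$ such that the underlying graph is a tree (connected, no cycles) and: (T1) each $p_i$ has at most one left parent, at most one right parent, at most one left child, at most one right child; (T2) if $\varepsilon_i=+$ then $p_i$ has at most one parent; (T3) if $\varepsilon_i=-$ then $p_i$ has at most one child; (T4) for every edge $(p_i,p_j)$ and every $i<k<j$: (a) if $p_k<p_i$ and $p_k<p_j$ then $\varepsilon_k=+$; (b) if $p_k>p_i$ and $p_k>p_j$ then $\varepsilon_k=-$. $\mathcal{T}/\mathbb{Z}$ is the quotient directed graph under the translation action $k\cdot p_i=p_{i+kn}$. $\mathcal{T}$ contains a unique translation-invariant doubly infinite path; ''$\mathcal{T}$ has an infinite monotonically increasing (resp. decreasing) path'' means that this path, traversed in the direction from $p_i$ to $p_{i+n}$ ($p_i$ any vertex on it), is increasing (resp. decreasing) in the partial order along every edge. An $n$-periodic morphism is a map $\psi:P_{\mathcal{T}}\to\mathbb{R}$ such that $m=\psi(p_{i+n})-\psi(p_i)$ is independent of $i$ and $\psi(p_i)<\psi(p_j)$ whenever $p_i<p_j$; its slope is $m/n$. *)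

(* Defs.v *)
(* MathComp + MathComp-Analysis. *)
From mathcomp Require Import all_boot all_order all_algebra.
From mathcomp Require Import boolp classical_sets reals.

Set Implicit Arguments.
Unset Strict Implicit.
Unset Printing Implicit Defensive.

Import Order.TTheory GRing.Theory Num.Theory.

Local Open Scope classical_set_scope.
Local Open Scope ring_scope.

Variant sign := Plus | Minus.

Definition periodic_sign (n : nat) (eps : int -> sign) : Prop :=
  forall i, eps (i + n%:Z) = eps i.

Section HasseDiagram.
Context {d : Order.disp_t} {P : porderType d}.
Implicit Types x y z : P.

(* [child x y]: x is a child of y, i.e. the Hasse diagram has an edge oriented
   from x to y. *)
Definition child : rel P :=
  [rel x y | (x < y)%O && `[< forall z, ~ ((x < z)%O /\ (z < y)%O) >]].

Definition adj : rel P := [rel x y | child x y || child y x].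

Definition hasse_generates : Prop :=
  forall x y, (x < y)%O -> exists s : seq P, path child x s /\ last x s = y.

Definition hasse_connected : Prop :=
  forall x y, exists s : seq P, path adj x s /\ last x s = y.

(* The length bound excludes the two-vertex closed walk along a single edge. *)
Definition hasse_acyclic : Prop :=
  forall c : seq P, (3 <= size c)%N -> ~ ucycle adj c.

End HasseDiagram.

Section PeriodicTree.
Context {d : Order.disp_t} {P : porderType d}.
Variables (n : nat) (p : int -> P).
Implicit Types i j k : int.

Record periodic_poset : Prop := PeriodicPoset {
  pp_bij : bijective p;
  pp_shift : forall i j, (p i < p j)%O = (p (i + n%:Z) < p (j + n%:Z))%O;
  pp_generates : @hasse_generates d P }.

(* [right_parent i j] reads "p j is a right parent of p i", and similarly for
   the other three. *)
Definition right_parent i j : Prop := i < j /\ child (p i) (p j).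
Definition left_parent  i j : Prop := j < i /\ child (p i) (p j).
Definition right_child  i j : Prop := i < j /\ child (p j) (p i).
Definition left_child   i j : Prop := j < i /\ child (p j) (p i).

Record periodic_tree (eps : int -> sign) : Prop := PeriodicTree {
  pt_poset : periodic_poset;
  pt_connected : @hasse_connected d P;
  pt_acyclic : @hasse_acyclic d P;
  pt_T1 : forall i,
    [/\ is_subset1 [set j | left_parent i j],
        is_subset1 [set j | right_parent i j],
        is_subset1 [set j | left_child i j]
      & is_subset1 [set j | right_child i j]];
  pt_T2 : forall i, eps i = Plus -> is_subset1 [set q | child (p i) q];
  pt_T3 : forall i, eps i = Minus -> is_subset1 [set q | child q (p i)];
  pt_T4 : forall i j k, adj (p i) (p j) -> i < k -> k < j ->
    ((p k < p i)%O -> (p k < p j)%O -> eps k = Plus) /\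
    ((p i < p k)%O -> (p j < p k)%O -> eps k = Minus) }.

(* Vertices of the quotient graph are the orbits of the translation action
   k . p_i = p_(i + k n). *)
Definition orbit i : set P := range (fun k : int => p (i + k * n%:Z)).

(* Parallel edges of the quotient with the same orientation are identified,
   which does not affect the existence of oriented cycles. *)
Definition quotient_edge : rel (set P) :=
  [rel A B | `[< exists i j, [/\ A = orbit i, B = orbit j
                               & child (p i) (p j)] >]].

(* The cycle [:: A] of length one is a loop at A; it arises from an edge between
   p_i and p_(i + k n). *)
Definition quotient_has_oriented_cycle : Prop :=
  exists c : seq (set P), (0 < size c)%N /\ ucycle quotient_edge c.

Definition biinfinite_path (g : int -> P) : Prop :=
  injective g /\ forall k, adj (g k) (g (k + 1)).

Definition path_edge (g : int -> P) (x y : P) : Prop :=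
  exists k, (x = g k /\ y = g (k + 1)) \/ (y = g k /\ x = g (k + 1)).

Definition translation_invariant (g : int -> P) : Prop :=
  forall i j, path_edge g (p i) (p j) <->
              path_edge g (p (i + n%:Z)) (p (j + n%:Z)).

(* g is traversed in the direction from p_i to p_(i + n), for p_i on g. *)
Definition forward (g : int -> P) : Prop :=
  forall i k l, g k = p i -> g l = p (i + n%:Z) -> k < l.

(* The translation-invariant doubly infinite path of a periodic tree is unique
   and so is its forward parametrization, up to a shift of the parameter. *)
Definition has_increasing_path : Prop :=
  exists g : int -> P,
    [/\ biinfinite_path g, translation_invariant g, forward g
      & forall k, (g k < g (k + 1))%O].

Definition has_decreasing_path : Prop :=
  exists g : int -> P,
    [/\ biinfinite_path g, translation_invariant g, forward g
      & forall k, (g (k + 1) < g k)%O].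

Definition periodic_morphism (R : realType) (psi : P -> R) : Prop :=
  (exists m : R, forall i, psi (p (i + n%:Z)) - psi (p i) = m) /\
  (forall x y, (x < y)%O -> psi x < psi y).

(* For a periodic morphism the numerator does not depend on the base index. *)
Definition slope (R : realType) (psi : P -> R) : R :=
  (psi (p n%:Z) - psi (p 0)) / n%:R.

End PeriodicTree.

Definition exactly_one (A B C : Prop) : Prop :=
  [\/ A, B | C] /\ [/\ ~ (A /\ B), ~ (A /\ C) & ~ (B /\ C)].

(* Main.v *)
Require Import Defs.
From mathcomp Require Import all_boot all_order all_algebra.
From mathcomp Require Import boolp classical_sets reals.
From mathcomp Require Import zify ring lra.

(** The translation x_i |-> x_(i+n) generates a free action of the integers on
    the tree by order automorphisms. As in any tree, such an action has an axis
    (lemma [axis_exists]): a shortest walk from a vertex to its translate,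
    prolonged by all translations, never backtracks, hence is an injective
    doubly infinite path g on which the translation acts as a shift by some
    r > 0. The whole trichotomy is read off the r edges of one period of g.

    If they all go up, then g is an increasing path, and a vertex lies below its
    translate; this makes every slope positive and closes up to an oriented
    cycle in the quotient. The case where they all go down is symmetric.

    If u > 0 of them go up and v > 0 go down, there is a morphism of slope zero
    ([balanced_morphism]). Since the Hasse diagram is a tree, any antisymmetric
    function on its oriented edges is the coboundary of a function on its
    vertices ([potential_exists]), and positive translation-invariant edge
    weights yield a periodic morphism ([weighted_morphism]). Giving weight v to
    the upward edges of g and weight u to the downward ones makes the total
    climb over one period equal to u v - v u = 0. A morphism of slope zero is
    constant on orbits and increases along oriented edges, so it forbids
    oriented cycles in the quotient as well as monotone invariant paths. *)

Set Implicit Arguments.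
Unset Strict Implicit.
Unset Printing Implicit Defensive.

Import Order.TTheory GRing.Theory Num.Theory.

Local Open Scope ring_scope.

(** * Sequences indexed by the integers *)

Lemma transitive_int (T : Type) (r : T -> T -> Prop) (g : int -> T) :
    (forall x y z, r x y -> r y z -> r x z) ->
    (forall k, r (g k) (g (k + 1))) ->
  forall k l, k < l -> r (g k) (g l).
Proof.
move=> r_trans rg k l lt_kl.
have -> : l = k + `|l - k|%N.-1.+1%:Z by lia.
elim: `|l - k|%N.-1 => [|m IHm]; first exact: rg.
by apply: r_trans IHm _; have := rg (k + m.+1%:Z); congr r; congr g; lia.
Qed.

Lemma periodic_mul (T : Type) (f : int -> T) (r : int) :
  (forall i, f (i + r) = f i) -> forall k i, f (i + k * r) = f i.
Proof.
move=> f_r; elim/int_ind=> [|m IHm|m IHm] i; first by rewrite mul0r addr0.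
  by rewrite -[RHS]IHm -[RHS]f_r; congr f; lia.
by rewrite -[RHS]IHm -f_r; congr f; lia.
Qed.

(** * Integrating edge weights over a tree *)

Section Potentials.
Context {T : eqType} {V : zmodType}.
Variables (e : rel T) (w : T -> T -> V).
Hypothesis e_irr : irreflexive e.
Hypothesis e_acyclic : forall c : seq T, (3 <= size c)%N -> ~ ucycle e c.
Hypothesis w_antisym : forall x y, w y x = - w x y.

Fixpoint walk_sum x (s : seq T) : V :=
  if s is y :: s' then w x y + walk_sum y s' else 0.

Lemma walk_sum_cat x s t :
  walk_sum x (s ++ t) = walk_sum x s + walk_sum (last x s) t.
Proof. by elim: s x => [|y s IHs] x /=; rewrite ?add0r // IHs addrA. Qed.

Lemma not_uniq_split (s : seq T) :
  ~~ uniq s -> exists y s1 s2 s3, s = rcons s1 y ++ rcons s2 y ++ s3.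
Proof.
elim: s => //= x s IHs; rewrite negb_and negbK => /orP[xs|/IHs].
  by case/path.splitP: xs => s2 s3; exists x, [::], s2, s3.
by case=> y [s1] [s2] [s3] ->; exists y, (x :: s1), s2, s3.
Qed.

(** A closed walk either revisits a vertex, and then splits into two shorter
    closed walks, or is a simple cycle; acyclicity leaves only the walk back and
    forth along one edge, where antisymmetry gives the cancellation. *)
Lemma closed_walk_sum x s : path e x s -> last x s = x -> walk_sum x s = 0.
Proof.
have [m] := ubnP (size s); elim: m s x => // m IHm s x lt_s_m es s_x.
have [us|/not_uniq_split[y [s1 [s2 [s3 def_s]]]]] := boolP (uniq s).
  case: s s_x es us {lt_s_m} => [|y [|z [|t s]]] //=.
  - by move=> ->; rewrite e_irr.
  - by move=> -> _ _; rewrite (w_antisym x) addr0 subrr.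
  - move=> s_x es us; case: (@e_acyclic [:: y, z, t & s]) => //.
    rewrite /ucycle/= us andbT rcons_path s_x.
    by move: es; rewrite andbCA; case/and4P=> -> -> -> ->.
move: es s_x lt_s_m; rewrite {s}def_s !cat_path !last_cat !last_rcons !size_cat.
rewrite !size_rcons => /and3P[es1 es2 es3] s3_x lt_s_m.
rewrite 2!walk_sum_cat !last_rcons.
rewrite [walk_sum y _](IHm _ y) ?last_rcons ?size_rcons ?add0r //; last by lia.
have := IHm (rcons s1 y ++ s3) x.
rewrite walk_sum_cat cat_path last_cat last_rcons es1 es3; apply=> //.
by rewrite size_cat size_rcons; lia.
Qed.

(** The potential at x is the weight of a chosen walk from the base point o to x.
    Closing that walk up by a chosen walk from y to o, directly when x = y and
    through the edge from x to y otherwise, compares the potentials at x and y. *)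
Lemma potential_exists (o : T) :
    (forall x y, exists s, path e x s /\ last x s = y) ->
  exists h : T -> V, forall x y, e x y -> h y - h x = w x y.
Proof.
move=> e_conn.
have [to toP] := choice (e_conn o); have [from fromP] := choice (e_conn^~ o).
exists (fun x => walk_sum o (to x)) => x y exy.
have [[to_x lto_x] [to_y lto_y]] := (toP x, toP y).
have [from_y lfrom_y] := fromP y.
have /closed_walk_sum : path e o (to y ++ from y) by rewrite cat_path to_y lto_y.
have /closed_walk_sum : path e o (to x ++ y :: from y).
  by rewrite cat_path to_x lto_x /= exy.
rewrite !last_cat !walk_sum_cat lto_x lto_y /= lfrom_y => /(_ erefl) sx /(_ erefl).
rewrite -sx addrA => /addIr ->.
by rewrite [X in X - _]addrC addrK.
Qed.

End Potentials.

(** * The axis of a free action of the integers on a tree *)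

Section Axis.
Context {T : eqType}.
Variables (e : rel T) (sh : int -> T -> T).
Hypothesis e_irr : irreflexive e.
Hypothesis e_conn : forall x y, exists s, path e x s /\ last x s = y.
Hypothesis e_acyclic : forall c : seq T, (3 <= size c)%N -> ~ ucycle e c.
Hypothesis shD : forall (a b : int) x, sh (a + b) x = sh a (sh b x).
Hypothesis sh_free : forall a x, sh a x = x -> a = 0.
Hypothesis sh_edge : forall a x y, e (sh a x) (sh a y) = e x y.

(** Two equal terms at minimal distance bound a simple cycle: distance 1 would
    be a loop at a vertex, and distance 2 a backtrack. *)
Lemma nonbacktracking_inj (g : int -> T) :
    (forall k, e (g k) (g (k + 1))) -> (forall k, g (k + 2) <> g k) ->
  injective g.
Proof.
move=> eg g_nb.
have no_return (m : nat) (a : int) : g (a + m.+1%:Z) <> g a.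
  have [N] := ubnP m; elim: N m a => // N IHN [|[|m]] a lt_m_N ga.
  - by have := eg a; rewrite ga e_irr.
  - by apply: (g_nb a); rewrite -[RHS]ga.
  pose f (j : nat) := g (a + j%:Z); pose c := [seq f j | j <- iota 1 m.+3].
  apply: (@e_acyclic c); first by rewrite size_map size_iota.
  have uc : uniq c.
    apply/(uniqP (g a)) => i j; rewrite !inE size_map size_iota => lt_i lt_j.
    rewrite !(nth_map 0%N) ?size_iota // !nth_iota // !add1n.
    wlog lt_ij : i j lt_i lt_j / (i < j)%N => [wlog_ij|] eq_ij.
      by case: (ltngtP i j) => // /wlog_ij H; [|symmetry]; apply: H.
    case: (IHN (j - i).-1 (a + i.+1%:Z)); first by lia.
    rewrite -[RHS]/(f i.+1) eq_ij; congr g; lia.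
  rewrite /ucycle uc andbT (cycle_path (g a)).
  have -> : last (g a) c = f 0%N.
    rewrite -nth_last size_map size_iota (nth_map 0%N) ?size_iota //.
    by rewrite nth_iota // add1n /f ga addr0.
  rewrite /c path_map.
  elim: {c uc ga lt_m_N}m.+3 0%N => //= N' IHN' k; rewrite {}IHN' andbT.
  by have := eg (a + k%:Z); congr e; congr g; lia.
move=> a b gab; case: (ltrgtP a b) => // ltab.
  case: (no_return `|b - a|%N.-1 a).
  by rewrite gab; congr g; lia.
case: (no_return `|a - b|%N.-1 b).
by rewrite -gab; congr g; lia.
Qed.

Record axis (g : int -> T) (r : nat) : Prop := Axis {
  axis_gt0 : (0 < r)%N;
  axis_inj : injective g;
  axis_edge : forall k, e (g k) (g (k + 1));
  axis_shift : forall k, g (k + r%:Z) = sh 1 (g k) }.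

Definition translation_walk r : Prop := exists f : nat -> T,
  (forall k, (k < r)%N -> e (f k) (f k.+1)) /\ f r = sh 1 (f 0).

(** Prolong a shortest walk from a vertex to its translate by all translations.
    A backtrack at g k could be cut off the walk g k, ..., g (k + r), leaving a
    shorter walk from g (k + 2) to its translate. *)
Lemma axis_exists (o : T) : exists g r, axis g r.
Proof.
have: exists r, `[< translation_walk r >].
  have [s [es ls]] := e_conn o (sh 1 o); exists (size s); apply/asboolP.
  exists (nth o (o :: s)); split=> [k lt_k|].
    by move/(pathP o): es; apply.
  by rewrite -ls (last_nth o).
case/ex_minnP=> r /asboolP[f [ef fr]] r_min.
have r_gt0 : (0 < r)%N.
  by case: (r) fr => // fr; have := sh_free (esym fr).
pose g (k : int) := sh (k %/ r)%Z (f `|(k %% r)%Z|%N).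
have gE (a : int) (b : nat) : (b < r)%N -> g (a * r%:Z + b%:Z) = sh a (f b).
  move=> lt_br; rewrite /g divzMDl ?modzMDl; last by lia.
  by rewrite divz_small ?modz_small ?addr0 ?absz_nat //; lia.
have divE k : exists a b, (b < r)%N /\ k = a * r%:Z + b%:Z.
  have r_neq0 : r%:Z != 0 by lia.
  have r_gt0z : 0 < r%:Z by lia.
  exists (k %/ r)%Z, `|(k %% r)%Z|%N; have := divz_eq k r.
  have := modz_ge0 k r_neq0; have := ltz_pmod k r_gt0z; lia.
have g_shift k : g (k + r%:Z) = sh 1 (g k).
  have [a [b [lt_br ->]]] := divE k.
  have -> : a * r%:Z + b%:Z + r%:Z = (1 + a) * r%:Z + b%:Z by lia.
  by rewrite !gE // shD.
have g_edge k : e (g k) (g (k + 1)).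
  have [a [b [lt_br ->]]] := divE k; rewrite gE //.
  have [b1_lt|] := ltnP b.+1 r.
    have -> : a * r%:Z + b%:Z + 1 = a * r%:Z + b.+1%:Z by lia.
    by rewrite gE // sh_edge ef.
  move=> b1_ge; have def_r : r = b.+1 by lia.
  have -> : a * r%:Z + b%:Z + 1 = (a + 1) * r%:Z + 0%N%:Z by rewrite def_r; lia.
  rewrite gE //.
  by rewrite shD -fr sh_edge def_r ef // def_r.
exists g, r; split=> //; apply: nonbacktracking_inj => // k g_back.
have [r_gt1|r_le1] := ltnP 1 r; last first.
  have def_r : r = 1%N by lia.
  (* A period of one edge leaves nothing to cut: a backtrack is then a vertex
     fixed by the second power of the translation. *)
  have: sh 2 (g k) = g k.
    by rewrite -[RHS]g_back (_ : 2 = 1 + 1) // shD -!g_shift def_r -addrA.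
  by move/sh_free.
suff /asboolP/r_min : translation_walk (r - 2) by lia.
exists (fun j => g (k + 2 + j%:Z)); split=> [j _|].
  by rewrite (_ : k + 2 + j.+1%:Z = k + 2 + j%:Z + 1) //; lia.
by rewrite addr0 g_back -g_shift; congr g; lia.
Qed.

End Axis.

(** * Hasse diagrams *)

Section HasseLemmas.
Context {d : Order.disp_t} {P : porderType d}.
Implicit Types x y z : P.

Lemma child_lt x y : child x y -> (x < y)%O.
Proof. by case/andP. Qed.

Lemma child_asym x y : child x y -> child y x = false.
Proof.
by move/child_lt=> ltxy; apply/negP=> /child_lt; rewrite lt_gtF.
Qed.

Lemma adj_irr : irreflexive (adj : rel P).
Proof. by move=> x; rewrite /adj /child /= ltxx. Qed.

End HasseLemmas.

(** * The translation action *)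

Section PeriodicPoset.
Context {d : Order.disp_t} {P : porderType d}.
Variables (n : nat) (p : int -> P) (q : P -> int).
Hypothesis n_gt0 : (0 < n)%N.
Hypothesis pK : cancel p q.
Hypothesis qK : cancel q p.
Hypothesis lt_shift1 : forall i j, (p i < p j)%O = (p (i + n%:Z) < p (j + n%:Z))%O.

Definition shift (a : int) (x : P) : P := p (q x + a * n%:Z).

Lemma shift0 x : shift 0 x = x.
Proof. by rewrite /shift mul0r addr0 qK. Qed.

Lemma shiftD a b x : shift (a + b) x = shift a (shift b x).
Proof. by rewrite /shift pK; congr p; ring. Qed.

Lemma shift1_p i : shift 1 (p i) = p (i + n%:Z).
Proof. by rewrite /shift pK mul1r. Qed.

Lemma shift_free a x : shift a x = x -> a = 0.
Proof. by move/(congr1 q); rewrite pK; nia. Qed.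

Lemma lt_shift a x y : (shift a x < shift a y)%O = (x < y)%O.
Proof.
have lt_shift1' z t : (shift 1 z < shift 1 t)%O = (z < t)%O.
  by rewrite -[z]qK -[t]qK !shift1_p -lt_shift1.
elim/int_ind: a x y => [|m IHm|m IHm] x y; first by rewrite !shift0.
  by rewrite intS !shiftD lt_shift1' IHm.
by rewrite -lt_shift1' -!shiftD intS opprD addNKr IHm.
Qed.

Lemma child_shift a x y : child (shift a x) (shift a y) = child x y.
Proof.
rewrite /child /= lt_shift; congr (_ && _); apply: asbool_equiv_eq.
split=> nz z; last rewrite -[z]shift0 -(subrr (- a)) opprK addrC shiftD !lt_shift //.
by have := nz (shift a z); rewrite !lt_shift.
Qed.

Lemma adj_shift a x y : adj (shift a x) (shift a y) = adj x y.
Proof. by rewrite /adj /= !child_shift. Qed.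

Lemma orbit_shift a i : Defs.orbit n p (i + a * n%:Z) = Defs.orbit n p i.
Proof.
apply/seteqP; split=> _ [k _ <-].
  by exists (a + k) => //; congr p; ring.
by exists (k - a) => //; congr p; ring.
Qed.

End PeriodicPoset.

(** * Morphisms, oriented cycles and monotone paths of a periodic tree *)

Section PeriodicTreeTheory.
Context {R : realType} {d : Order.disp_t} {P : porderType d}.
Variables (n : nat) (p : int -> P) (q : P -> int).
Hypothesis n_gt0 : (0 < n)%N.
Hypothesis pK : cancel p q.
Hypothesis qK : cancel q p.
Hypothesis lt_shift1 : forall i j, (p i < p j)%O = (p (i + n%:Z) < p (j + n%:Z))%O.
Hypothesis P_gen : @hasse_generates d P.
Hypothesis P_conn : @hasse_connected d P.
Hypothesis P_acyc : @hasse_acyclic d P.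

Local Notation shift := (shift n p q).
Implicit Types (psi : P -> R) (x y z : P).

(** A directed path from x to y projects to a closed directed walk in the
    quotient, from which the loops are then erased. *)
Lemma oriented_cycle_of_lt x y :
    (x < y)%O -> Defs.orbit n p (q x) = Defs.orbit n p (q y) ->
  quotient_has_oriented_cycle n p.
Proof.
pose o x := Defs.orbit n p (q x); rewrite -/(o x) -/(o y).
have child_o z t : child z t -> quotient_edge n p (o z) (o t).
  by move=> zt; apply/asboolP; exists (q z), (q t); rewrite !qK.
move=> ltxy oxy; have [[|z s] /= [xs s_y]] := P_gen ltxy.
  by rewrite s_y ltxx in ltxy.
case/andP: xs => /child_o xz zs.
have {}zs : path (quotient_edge n p) (o z) (map o s).
  by rewrite path_map; apply: sub_path zs.
have := erefl (last (o z) (map o s)); rewrite {1}last_map s_y -oxy.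
case/shortenP: zs => s' zs' us' _ s'_x.
exists (o z :: s'); split=> //; rewrite /ucycle us' andbT /= rcons_path zs'.
by rewrite -s'_x xz.
Qed.

Lemma slopeE psi i : periodic_morphism n p psi ->
  psi (p (i + n%:Z)) - psi (p i) = slope n p psi * n%:R.
Proof.
case=> [[m psi_m] _]; rewrite psi_m /slope -[n%:Z]add0r psi_m divfK //.
by rewrite pnatr_eq0; lia.
Qed.

Lemma slope_gt0 psi i :
  periodic_morphism n p psi -> (p i < p (i + n%:Z))%O -> 0 < slope n p psi.
Proof.
move=> psiM lt_i; have := psiM.2 _ _ lt_i.
by rewrite -subr_gt0 slopeE // pmulr_lgt0 // ltr0n.
Qed.

Lemma slope_lt0 psi i :
  periodic_morphism n p psi -> (p (i + n%:Z) < p i)%O -> slope n p psi < 0.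
Proof.
move=> psiM lt_i; have := psiM.2 _ _ lt_i.
by rewrite -subr_lt0 slopeE // pmulr_llt0 // ltr0n.
Qed.

(** With slope zero, psi descends to the quotient, where it increases strictly
    along every oriented edge. *)
Lemma acyclic_of_slope0 psi :
    periodic_morphism n p psi -> slope n p psi = 0 ->
  ~ quotient_has_oriented_cycle n p.
Proof.
move=> psiM psi0.
have psi_step i : psi (p (i + n%:Z)) = psi (p i).
  by apply/eqP; rewrite -subr_eq0 slopeE // psi0 mul0r.
have psi_shift i k : psi (p (i + k * n%:Z)) = psi (p i).
  exact: (periodic_mul (f := psi \o p)).
have psi_orbit i j : Defs.orbit n p i = Defs.orbit n p j -> psi (p i) = psi (p j).
  move=> eq_ij; have: Defs.orbit n p j (p i).
    by rewrite -eq_ij; exists 0; rewrite ?mul0r ?addr0.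
  by case=> k _ <-.
have psi_path s : forall A B i, path (quotient_edge n p) A (rcons s B) ->
    A = Defs.orbit n p i -> exists j, B = Defs.orbit n p j /\ psi (p i) < psi (p j).
  have psi_edge A B i : quotient_edge n p A B -> A = Defs.orbit n p i ->
      exists j, B = Defs.orbit n p j /\ psi (p i) < psi (p j).
    case/asboolP=> i' [j [-> -> /child_lt/psiM.2 lt_psi]] /psi_orbit <-.
    by exists j.
  elim: s => [|C s IHs] A B i /=; first by rewrite andbT; apply: psi_edge.
  case/andP=> /psi_edge AC CB /AC[j [/(IHs _ _ _ CB)[k [-> lt_jk]] lt_ij]].
  by exists k; split=> //; apply: lt_trans lt_jk.
case=> -[|A s] [] // _ /andP[As _].
have [i def_A] : exists i, A = Defs.orbit n p i.
  by move: As; case: s => [|B s] /= /andP[/asboolP[i [j [-> _ _]]] _]; exists i.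
have [j [def_A' ]] := psi_path _ _ _ _ As def_A.
by rewrite (psi_orbit i j) ?ltxx // -def_A.
Qed.

(** Integrate the weight a, counted positively when going up an edge and
    negatively when going down. Invariance of a makes the increment of psi
    between a vertex and its translate the same at both ends of each edge, hence
    constant by connectedness. *)
Lemma weighted_morphism (a : P -> P -> R) :
    (forall x y, 0 < a x y) ->
    (forall x y, a (shift 1 x) (shift 1 y) = a x y) ->
  exists psi, periodic_morphism n p psi /\
    forall x y, child x y -> psi y - psi x = a x y.
Proof.
move=> a_gt0 a_shift.
pose w x y := (child x y)%:R * a x y - (child y x)%:R * a y x.
have wN x y : w y x = - w x y by rewrite /w opprB.
have [psi psiE] := potential_exists adj_irr P_acyc wN (p 0) P_conn.
have psi_child x y : child x y -> psi y - psi x = a x y.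
  move=> xy; rewrite psiE /adj /= ?xy // /w xy child_asym // mul0r subr0 mul1r //.
exists psi; split=> //; split; last first.
  have psi_lt x y : child x y -> psi x < psi y.
    by move=> xy; rewrite -subr_gt0 psi_child.
  have psi_le s x : path child x s -> psi x <= psi (last x s).
    elim: s x => //= y s IHs x /andP[/psi_lt/ltW le_xy /IHs].
    exact: le_trans.
  move=> x y lt_xy; have [[|z s] /= [xs s_y]] := P_gen lt_xy.
    by rewrite s_y ltxx in lt_xy.
  case/andP: xs => /psi_lt lt_xz /psi_le le_zy.
  by rewrite -s_y; apply: lt_le_trans le_zy.
exists (psi (shift 1 (p 0)) - psi (p 0)) => i; rewrite -(shift1_p n pK).
have [s [es <-]] := P_conn (p 0) (p i).
elim: s (p 0) es => //= y s IHs x /andP[xy /IHs ->].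
have := psiE (shift 1 x) (shift 1 y).
rewrite adj_shift // /w !child_shift // !a_shift -/(w x y) => /(_ xy).
by rewrite -psiE //; lra.
Qed.

Lemma axis_translation_path g r : axis adj shift g r ->
  [/\ biinfinite_path g, translation_invariant n p g & forward n p g].
Proof.
case=> r_gt0 g_inj g_edge g_shift; split=> // [i j|i k l gk gl].
  have shift_g k i' : p i' = g k <-> p (i' + n%:Z) = g (k + r%:Z).
    rewrite g_shift -(shift1_p n pK); split=> [-> //|].
    by move/(congr1 (shift (-1))); rewrite -!shiftD // !shift0.
  split=> -[k pk].
    exists (k + r%:Z); rewrite (addrAC k).
    by case: pk => -[/shift_g-> /shift_g->]; [left | right].
  exists (k - r%:Z).
  by case: pk => -[gi gj]; [left | right]; split; apply/shift_g; rewrite ?gi ?gj;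
    congr g; lia.
suff -> : l = k + r%:Z by lia.
by apply: g_inj; rewrite gl g_shift gk shift1_p.
Qed.

(** The translate of the edge from g 0 to g 1 is again an edge of the path, so the
    translate of g 0 is some g l, and l > 0 because g runs forward. *)
Lemma invariant_path_step g :
    translation_invariant n p g -> forward n p g ->
  exists i l, [/\ g 0 = p i, g l = p (i + n%:Z) & 0 < l].
Proof.
move=> g_inv g_fwd; exists (q (g 0)).
have [l gl] : exists l, g l = p (q (g 0) + n%:Z).
  have [] := g_inv (q (g 0)) (q (g 1)); rewrite !qK => gn _.
  have [|k] := gn; first by exists 0; left; rewrite add0r.
  by case=> -[] gk gk'; [exists k | exists (k + 1)].
exists l; rewrite qK; split=> //.
by apply: (g_fwd (q (g 0))); rewrite // qK.
Qed.

Lemma increasing_step : has_increasing_path n p -> exists i, (p i < p (i + n%:Z))%O.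
Proof.
case=> g [_ g_inv g_fwd g_inc].
have [i [l [gi gl l_gt0]]] := invariant_path_step g_inv g_fwd.
exists i; rewrite -gi -gl.
by apply: (@transitive_int _ (fun x y => (x < y)%O)) => // x y z; apply: lt_trans.
Qed.

Lemma decreasing_step : has_decreasing_path n p -> exists i, (p (i + n%:Z) < p i)%O.
Proof.
case=> g [_ g_inv g_fwd g_dec].
have [i [l [gi gl l_gt0]]] := invariant_path_step g_inv g_fwd.
exists i; rewrite -gi -gl.
apply: (@transitive_int _ (fun x y => (y < x)%O)) => // x y z xy yz.
exact: lt_trans xy.
Qed.

(** If a period of the axis has u upward and v downward edges, weight v on the
    former and u on the latter makes the climb over the period cancel out; off the
    axis any invariant positive weight will do, and u is one. *)
Lemma balanced_morphism g r (k1 k2 : int) :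
    axis adj shift g r ->
    child (g k1) (g (k1 + 1)) -> ~~ child (g k2) (g (k2 + 1)) ->
  exists psi, periodic_morphism n p psi /\ slope n p psi = 0.
Proof.
move=> [r_gt0 g_inj g_edge g_shift] up1 down2.
pose up (k : int) := child (g k) (g (k + 1)).
have up_r k : up (k + r%:Z) = up k.
  by rewrite /up addrAC !g_shift child_shift.
have up_mod k : exists i : 'I_r, up i%:Z = up k.
  have r_neq0 : r%:Z != 0 by lia.
  have r_gt0z : 0 < r%:Z by lia.
  have k_ge0 := modz_ge0 k r_neq0; have k_lt := ltz_pmod k r_gt0z.
  have lt_kr : (`|(k %% r)%Z|%N < r)%N by lia.
  exists (Ordinal lt_kr); rewrite -(periodic_mul up_r (k %/ r)%Z); congr up => /=.
  by have := divz_eq k r; lia.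
pose u := #|[pred i : 'I_r | up i%:Z]|; pose v := #|[pred i : 'I_r | ~~ up i%:Z]|.
have u_gt0 : (0 < u)%N.
  by have [i upi] := up_mod k1; apply/card_gt0P; exists i; rewrite inE upi.
have v_gt0 : (0 < v)%N.
  by have [i upi] := up_mod k2; apply/card_gt0P; exists i; rewrite inE upi.
pose along x y := `[< exists k, x = g k /\ y = g (k + 1) >].
pose a x y : R := if along x y then v%:R else u%:R.
have a_gt0 x y : 0 < a x y by rewrite /a; case: ifP; rewrite ltr0n.
have a_shift x y : a (shift 1 x) (shift 1 y) = a x y.
  rewrite /a /along; congr (if _ then _ else _); apply: asbool_equiv_eq.
  have shift1_inj : injective (shift 1).
    by move=> z t /(congr1 (shift (-1))); rewrite -!shiftD // !shift0.
  split=> -[k]; last by case=> -> ->; exists (k + r%:Z); rewrite addrAC !g_shift.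
  rewrite -(subrK r%:Z k) (addrAC _ _ 1) !g_shift => -[/shift1_inj-> /shift1_inj->].
  by exists (k - r%:Z).
have [psi [psiM psiE]] := weighted_morphism a_gt0 a_shift.
exists psi; split=> //.
have psi_step k : psi (g (k + 1)) - psi (g k) = if up k then v%:R else - u%:R.
  case: ifPn => [up_k|down_k].
    rewrite psiE // /a ifT //; apply/asboolP; by exists k.
  have {}down_k : child (g (k + 1)) (g k).
    by have := g_edge k; rewrite /adj /= -/(up k) (negbTE down_k).
  (* By injectivity of g, a downward edge of the axis is not traversed upwards
     elsewhere on the axis. *)
  rewrite -opprB psiE // /a ifF //; apply/asboolP=> -[j [/g_inj e1 /g_inj e2]].
  lia.
have: psi (g r%:Z) - psi (g 0) = 0.
  rewrite -(telescope_sumr (fun k : nat => psi (g k%:Z))) // big_mkord.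
  under eq_bigr => i _ do rewrite -addn1 PoszD psi_step.
  by rewrite big_if /= !sumr_const -/u -/v mulNrn -!mulrnA mulnC subrr.
rewrite -[r%:Z]add0r g_shift -[g 0]qK shift1_p // slopeE // => /eqP.
by rewrite mulf_eq0 pnatr_eq0 eqn0Ngt n_gt0 orbF => /eqP.
Qed.

Lemma tree_trichotomy :
  [\/ exists psi, periodic_morphism n p psi /\ slope n p psi = 0,
      has_increasing_path n p | has_decreasing_path n p].
Proof.
have [g [r g_axis]] := axis_exists adj_irr P_conn P_acyc (shiftD n pK)
  (shift_free n_gt0 pK) (adj_shift pK qK lt_shift1) (p 0).
have [g_path g_inv g_fwd] := axis_translation_path g_axis.
have [[k1 up1]|no_up] := pselect (exists k, child (g k) (g (k + 1))); last first.
  apply: Or33; exists g; split=> // k; apply: child_lt.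
  by have /orP[up_k|//] := g_path.2 k; case: no_up; exists k.
have [[k2 down2]|no_down] := pselect (exists k, ~~ child (g k) (g (k + 1))).
  by apply: Or31; apply: balanced_morphism g_axis up1 down2.
apply: Or32; exists g; split=> // k; apply: child_lt.
by apply/negPn/negP => down_k; case: no_down; exists k.
Qed.

End PeriodicTreeTheory.

(** * The classification *)

Theorem theorem1p2p6 (R : realType) (d : Order.disp_t) (P : porderType d)
    (p : int -> P) (n : nat) (eps : int -> sign) (hn : (2 <= n)%N)
    (heps : periodic_sign n eps) (hT : periodic_tree n p eps) :
  exactly_one (~ quotient_has_oriented_cycle n p)
              (has_increasing_path n p)
              (has_decreasing_path n p) /\
  [/\ ~ quotient_has_oriented_cycle n p <->
        (exists psi : P -> R, periodic_morphism n p psi /\ slope n p psi = 0),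
      has_increasing_path n p <->
        (forall psi : P -> R, periodic_morphism n p psi -> 0 < slope n p psi)
    & has_decreasing_path n p <->
        (forall psi : P -> R, periodic_morphism n p psi -> slope n p psi < 0)].
Proof.
have n_gt0 : (0 < n)%N by lia.
case: hT => -[[q pK qK] lt_shift1 P_gen] P_conn P_acyc _ _ _ _.
pose inc := has_increasing_path n p; pose dec := has_decreasing_path n p.
have inc_pos : inc -> forall psi : P -> R,
    periodic_morphism n p psi -> 0 < slope n p psi.
  by case/(increasing_step qK) => i lt_i psi psiM; apply: slope_gt0 lt_i.
have dec_neg : dec -> forall psi : P -> R,
    periodic_morphism n p psi -> slope n p psi < 0.
  by case/(decreasing_step qK) => i lt_i psi psiM; apply: slope_lt0 lt_i.
have orbit1 i : Defs.orbit n p (i + n%:Z) = Defs.orbit n p i.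
  by have := orbit_shift n p 1 i; rewrite mul1r.
have inc_cycle : inc -> quotient_has_oriented_cycle n p.
  case/(increasing_step qK) => i lt_i.
  by apply: (oriented_cycle_of_lt qK P_gen lt_i); rewrite !pK orbit1.
have dec_cycle : dec -> quotient_has_oriented_cycle n p.
  case/(decreasing_step qK) => i lt_i.
  by apply: (oriented_cycle_of_lt qK P_gen lt_i); rewrite !pK orbit1.
have acyc0 (psi : P -> R) := @acyclic_of_slope0 R d P n p n_gt0 psi.
(* Weight 1 on every edge gives some periodic morphism, so that the conditions
   on the slopes of all morphisms are not vacuous. *)
have [psi1 [psi1M _]] := weighted_morphism pK qK lt_shift1 P_gen P_conn P_acyc
  (a := fun _ _ => 1 : R) (fun _ _ => ltr01) (fun _ _ => erefl).
have := @tree_trichotomy R d P n p q n_gt0 pK qK lt_shift1 P_gen P_conn P_acyc.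
rewrite /exactly_one -/inc -/dec.
have inc_dec : inc -> ~ dec.
  by move=> /inc_pos/(_ _ psi1M) lt0 /dec_neg/(_ _ psi1M); rewrite ltNge ltW.
case=> [[psi [psiM psi0]]|incT|decT].
- have acyc := acyc0 psi psiM psi0.
  have not_inc : ~ inc by move/inc_cycle.
  have not_dec : ~ dec by move/dec_cycle.
  split; [split; [exact: Or31 | by split; tauto] | split; split=> //].
  + by exists psi.
  + by move/(_ _ psiM); rewrite psi0 ltxx.
  + by move/(_ _ psiM); rewrite psi0 ltxx.
- have cyc := inc_cycle incT; have not_dec := inc_dec incT.
  split; [split; [exact: Or32 | by split; tauto] | split; split=> //].
  + by case=> psi [psiM psi0]; case: (acyc0 psi).
  + by move/(_ _ psi1M); rewrite ltNge ltW // inc_pos.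
- have cyc := dec_cycle decT.
  have not_inc : ~ inc by move=> incT; apply: inc_dec decT.
  split; [split; [exact: Or33 | by split; tauto] | split; split=> //].
  + by case=> psi [psiM psi0]; case: (acyc0 psi).
  + by move/(_ _ psi1M); rewrite ltNge ltW // dec_neg.
Qed.
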